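(* Let $g,n\in\mathbb{N}$ with $g>3$ and $2\le n\le g-2$, and let $\mathcal{F}_{g,n}$ be the set of leaves of the tree $\mathcal{T}_{g,n}$. Suppose that (1) every $S\in\mathcal{F}_{g,n}$ satisfies Wilf's inequality, and (2) $\mathcal{A}(S)$ satisfies Wilf's inequality for every $S\in\mathcal{F}_{g,n}$ such that $\{x\in\mathbb{N}\mid \operatorname{F}(S)-\operatorname{m}(S)+1\le x<\operatorname{F}(S)\}\subseteq S$. Then every numerical semigroup in $\mathcal{H}_{g,n}$ satisfies Wilf's inequality.
   Context: $\mathbb{N}=\{0,1,2,\ldots\}$. A numerical semigroup is a submonoid $S$ of $(\mathbb{N},+)$ with $\mathbb{N}\setminus S$ finite. $\operatorname{H}(S)=\mathbb{N}\setminus S$; $\operatorname{g}(S)=|\operatorname{H}(S)|$; $\operatorname{F}(S)=\max\operatorname{H}(S)$; $\operatorname{m}(S)=\min(S\setminus\{0\})$; $\operatorname{n}(S)=|\{s\in S\mid s<\operatorname{F}(S)\}|$; $\operatorname{e}(S)$ is the number of minimal generators of $S$. $S$ satisfies Wilf's inequality if $\operatorname{e}(S)\operatorname{n}(S)\ge\operatorname{F}(S)+1$. Special gaps: $\operatorname{SG}(S)=\{h\in\operatorname{H}(S)\mid 2h\in S \text{ and } h+s\in S \text{ for all } s\in S\setminus\{0\}\}$. $S$ is special if there is no $h\in\operatorname{SG}(S)\setminus\{\operatorname{F}(S)\}$ with $h>\operatorname{m}(S)$. For non special $S$, $\mathcal{A}(S)=(S\cup\{h\})\setminus\{\operatorname{m}(S)\}$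 with $h=\max(\operatorname{SG}(S)\setminus\{\operatorname{F}(S)\})$. $S_{g,n}=\{0\}\cup\{g,\ldots,g+n-2\}\cup\{x\in\mathbb{N}\mid x\ge g+n\}$. $\mathcal{H}_{g,n}$ is the set consisting of $S_{g,n}$ and all non special numerical semigroups $S$ with $\operatorname{g}(S)=g$, $\operatorname{n}(S)=n$. $\mathcal{T}_{g,n}$ is the oriented graph with vertex set $\mathcal{H}_{g,n}$ and edges all pairs $(S,\mathcal{A}(S))$ with $S\in\mathcal{H}_{g,n}$ non special; $S$ is a child of $T$ if $(S,T)$ is an edge, and a leaf is a vertex with no children. *)

(* Defs.v *)
From mathcomp Require Import all_boot all_order finmap.
From mathcomp Require Import mathcomp_extra boolp classical_sets cardinality.

Set Implicit Arguments.
Unset Strict Implicit.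
Unset Printing Implicit Defensive.

Local Open Scope classical_set_scope.

Definition submonoid (S : set nat) : Prop :=
  S 0 /\ forall x y, S x -> S y -> S (x + y).

Definition gaps (S : set nat) : set nat := ~` S.

Definition numerical_semigroup (S : set nat) : Prop :=
  submonoid S /\ finite_set (gaps S).

(* The value is 0 when A has no least (resp. greatest) element. *)
Definition minimum (A : set nat) : nat :=
  xget 0 [set x | A x /\ forall y, A y -> x <= y].
Definition maximum (A : set nat) : nat :=
  xget 0 [set x | A x /\ forall y, A y -> y <= x].

(* The value is 0 when A is infinite. *)
Definition card_of (A : set nat) : nat := #|` fset_set A|%fset.

Definition genus (S : set nat) : nat := card_of (gaps S).

(* frobenius setT is 0 rather than the usual -1. *)
Definition frobenius (S : set nat) : nat := maximum (gaps S).

Definition multiplicity (S : set nat) : nat := minimum (S `\ 0).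

Definition nleft (S : set nat) : nat :=
  card_of [set s | S s /\ s < frobenius S].

Definition generates (A S : set nat) : Prop := smallest submonoid A = S.

Definition minimal_generating_set (A S : set nat) : Prop :=
  generates A S /\ forall B, B `<=` A -> generates B S -> B = A.

(* A numerical semigroup has exactly one minimal generating set, and it is
   finite, so this is that set. *)
Definition minimal_generators (S : set nat) : set nat :=
  [set x | exists2 A, minimal_generating_set A S & A x].

Definition embdim (S : set nat) : nat := card_of (minimal_generators S).

Definition wilf (S : set nat) : Prop :=
  frobenius S + 1 <= embdim S * nleft S.

Definition special_gaps (S : set nat) : set nat :=
  [set h | [/\ gaps S h, S (2 * h) & forall s, (S `\ 0) s -> S (h + s)]].

Definition special (S : set nat) : Prop :=
  ~ exists2 h, (special_gaps S `\ frobenius S) h & multiplicity S < h.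

(* Meaningful only for non special numerical semigroups. *)
Definition transfA (S : set nat) : set nat :=
  (S `|` [set maximum (special_gaps S `\ frobenius S)]) `\ multiplicity S.

(* Meant for 2 <= n, where the subtraction is not truncated. *)
Definition Sgn (g n : nat) : set nat :=
  [set x | [\/ x = 0, g <= x <= g + n - 2 | g + n <= x]].

Definition Hgn (g n : nat) : set (set nat) :=
  [set S | S = Sgn g n \/
           [/\ numerical_semigroup S, ~ special S, genus S = g & nleft S = n]].

(* The graph T_{g,n} has vertex set Hgn g n; Tgn_edge g n S T says that (S, T)
   is an edge, i.e. that S is a child of T. *)
Definition Tgn_edge (g n : nat) (S T : set nat) : Prop :=
  [/\ Hgn g n S, ~ special S & T = transfA S].

Definition leaves (g n : nat) : set (set nat) :=
  [set T | Hgn g n T /\ ~ exists S, Tgn_edge g n S T].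

(* Main.v *)
(* Passing from S to A(S) keeps F and n and raises the multiplicity, so one
   inducts on the multiplicity. If some gap of S lies strictly between F - m
   and F, then h is the largest gap below F; the minimal generators of S lost in
   A(S) are then at most m and F + m, while h and 2m are gained, so e does not
   decrease and Wilf's inequality passes from S to A(S). Otherwise S is itself a
   leaf, and the second hypothesis applies to it. *)

Require Import Defs.
From mathcomp Require Import all_boot all_order finmap.
From mathcomp Require Import mathcomp_extra boolp classical_sets cardinality.
From mathcomp Require Import zify.

Set Implicit Arguments.
Unset Strict Implicit.
Unset Printing Implicit Defensive.

Local Open Scope classical_set_scope.

(** * Extrema and cardinalities of sets of naturals *)

Lemma minimumP (A : set nat) : A !=set0 ->
  A (minimum A) /\ forall y, A y -> minimum A <= y.
Proof.
move=> [a Aa]; apply: (xgetPex 0 (P := [set x | A x /\ forall y, A y -> x <= y])).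
have exA : exists i, `[< A i >] by exists a; apply/asboolP.
case: (ex_minnP exA) => x /asboolP Ax xP; exists x; split=> // y Ay.
by apply: xP; apply/asboolP.
Qed.

Lemma maximumP (A : set nat) (b : nat) : A !=set0 ->
  (forall x, A x -> x <= b) -> A (maximum A) /\ forall y, A y -> y <= maximum A.
Proof.
move=> [a Aa] Ab; apply: (xgetPex 0 (P := [set x | A x /\ forall y, A y -> y <= x])).
have exA : exists i, `[< A i >] by exists a; apply/asboolP.
have bA i : `[< A i >] -> i <= b by move/asboolP; exact: Ab.
case: (ex_maxnP exA bA) => x /asboolP Ax xP; exists x; split=> // y Ay.
by apply: xP; apply/asboolP.
Qed.

Lemma finite_set_bounded (A : set nat) :
  finite_set A -> exists b, forall x, A x -> x <= b.
Proof.
move=> fA; exists (\max_(i <- fset_set A) i) => x Ax.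
by apply: (@leq_bigmax_seq _ _ xpredT id) => //; rewrite in_fset_set // inE.
Qed.

Lemma bounded_finite_set (A : set nat) (b : nat) :
  (forall x, A x -> x <= b) -> finite_set A.
Proof. by move=> Ab; apply: (sub_finite_set _ (finite_II b.+1)) => x /Ab. Qed.

Lemma leq_card_of (A B : set nat) : finite_set B -> A `<=` B ->
  card_of A <= card_of B.
Proof.
move=> fB AB; have fA := sub_finite_set AB fB.
by apply: fsubset_leq_card; rewrite -fset_set_sub.
Qed.

Lemma card_ofD1 (A : set nat) (x : nat) : finite_set A ->
  card_of A = `[< A x >] + card_of (A `\ x).
Proof.
move=> fA; rewrite /card_of fset_setD1 // (cardfsD1 x) in_fset_set //.
Qed.

(** * Frobenius number, multiplicity and special gaps *)

Lemma frobeniusP (S : set nat) : numerical_semigroup S -> gaps S !=set0 ->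
  ~ S (frobenius S) /\ forall y, ~ S y -> y <= frobenius S.
Proof. by move=> [_ /finite_set_bounded[b bP]] Sne; exact: maximumP bP. Qed.

Lemma multiplicityP (S : set nat) : numerical_semigroup S ->
  [/\ 0 < multiplicity S, S (multiplicity S)
    & forall s, S s -> 0 < s -> multiplicity S <= s].
Proof.
move=> [_ /finite_set_bounded[b bP]].
have /minimumP[[Sm /eqP m0] mP] : S `\ 0 !=set0.
  exists b.+1; split=> //; apply: contrapT => /bP; lia.
split=> //; first by rewrite lt0n.
by move=> s Ss s0; apply: mP; split=> // /= s0'; lia.
Qed.

Lemma special_gapsP (S : set nat) (h : nat) : special_gaps S h <->
  [/\ ~ S h, S (2 * h) & forall s, S s -> 0 < s -> S (h + s)].
Proof.
split=> -[nSh S2h hP]; split=> // s.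
  by move=> Ss s0; apply: hP; split=> //= ?; lia.
by move=> [Ss /= s0]; apply: hP => //; lia.
Qed.

(* The [h] of the definition of A(S). *)
Definition pivot (S : set nat) : nat :=
  maximum (special_gaps S `\ frobenius S).

Lemma non_special_gaps (S : set nat) : ~ special S -> gaps S !=set0.
Proof. by move=> /contrapT[h [[nSh _ _] _] _]; exists h. Qed.

Lemma pivotP (S : set nat) : numerical_semigroup S -> ~ special S ->
  [/\ special_gaps S (pivot S), multiplicity S < pivot S,
      pivot S < frobenius S
    & forall y, special_gaps S y -> y <> frobenius S -> y <= pivot S].
Proof.
move=> numS nspS; have [_ FP] := frobeniusP numS (non_special_gaps nspS).
have [k kP mk] := contrapT nspS.
have [||[hS hF] hP] := @maximumP (special_gaps S `\ frobenius S) (frobenius S).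
- by exists k.
- by move=> x [[nSx _ _] _]; exact: FP.
split=> //.
- by apply: (leq_trans mk); exact: hP.
- have [nSh _ _] := hS; have := FP _ nSh.
  rewrite leq_eqVlt => /orP[/eqP|] //.
- by move=> y yS yF; apply: hP; split.
Qed.

(** * The transform A(S) and its invariants *)

Lemma transfAP (S : set nat) (x : nat) :
  numerical_semigroup S -> ~ special S ->
  transfA S x <-> S x /\ x <> multiplicity S \/ x = pivot S.
Proof.
move=> numS nspS; have [_ mh _ _] := pivotP numS nspS.
split=> [[[Sx|->] /= xm]|[[Sx xm]|->]]; [by left|by right|..].
  by split=> //; left.
by split=> /=; [right|lia].
Qed.

(** The added gap [pivot S] also exceeds the removed multiplicity. This strict growth gives closure
    under addition below and makes the final induction decrease. *)
Lemma transfA_gt (S : set nat) (x : nat) :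
  numerical_semigroup S -> ~ special S -> transfA S x -> 0 < x ->
  multiplicity S < x.
Proof.
move=> numS nspS /transfAP-/(_ numS nspS) Tx x0.
have [_ _ mP] := multiplicityP numS; have [_ mh _ _] := pivotP numS nspS.
by case: Tx => [[Sx xm]|->] //; have := mP _ Sx x0; lia.
Qed.

(** A sum of two nonzero elements of A(S) exceeds m, so it is never the removed element; sums
    involving h stay in S because h is a special gap. *)
Lemma transfA_numerical (S : set nat) :
  numerical_semigroup S -> ~ special S -> numerical_semigroup (transfA S).
Proof.
move=> numS nspS; have TP := transfAP _ numS nspS.
have Tgt x := @transfA_gt S x numS nspS.
have [m0 Sm mP] := multiplicityP numS.
have [/special_gapsP[nSh S2h hP] mh _ _] := pivotP numS nspS.
have [[S0 SD] fS] := numS.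
split; last first.
  apply: (sub_finite_set (B := gaps S `|` [set multiplicity S])).
    move=> x nTx; apply: contrapT => /not_orP[/contrapT Sx xm].
    by apply: nTx; apply/TP; left.
  by rewrite finite_setU; split => //; exact: finite_set1.
split; first by apply/TP; left; split=> //; lia.
move=> x y Tx Ty.
have [->//|x0] := posnP x; have [->|y0] := posnP y; first by rewrite addn0.
have mx := Tgt _ Tx x0; have my := Tgt _ Ty y0.
apply/TP; left; split; last by lia.
case/TP: Tx => [[Sx _]|->]; case/TP: Ty => [[Sy _]|->].
- exact: SD.
- by rewrite addnC; exact: hP.
- exact: hP.
- by rewrite addnn -mul2n.
Qed.

(** As m < h < F, the gap F is not filled and the new gap m lies below it. *)
Lemma frobenius_transfA (S : set nat) :
  numerical_semigroup S -> ~ special S -> frobenius (transfA S) = frobenius S.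
Proof.
move=> numS nspS; have TP := transfAP _ numS nspS.
have [nSF FP] := frobeniusP numS (non_special_gaps nspS).
have [_ mh hF _] := pivotP numS nspS.
have nTF : ~ transfA S (frobenius S) by move=> /TP[[]//|]; lia.
have [|nTF' F'P] := frobeniusP (transfA_numerical numS nspS).
  by exists (frobenius S).
apply/eqP; rewrite eqn_leq F'P // andbT.
have [SF'|/FP//] := pselect (S (frobenius (transfA S))).
have [->|Fm] := eqVneq (frobenius (transfA S)) (multiplicity S); first by lia.
by case: nTF'; apply/TP; left; split=> //; exact/eqP.
Qed.

(** Among the elements below F, exactly m is exchanged for h. *)
Lemma nleft_transfA (S : set nat) :
  numerical_semigroup S -> ~ special S -> nleft (transfA S) = nleft S.
Proof.
move=> numS nspS; have TP := transfAP _ numS nspS.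
have [m0 Sm _] := multiplicityP numS.
have [/special_gapsP[nSh _ _] mh hF _] := pivotP numS nspS.
rewrite /nleft frobenius_transfA //.
have fin (A : set nat) : finite_set [set s | A s /\ s < frobenius S].
  by apply: (@bounded_finite_set _ (frobenius S)) => x [_] /ltnW.
rewrite (card_ofD1 (pivot S) (fin (transfA S))) (card_ofD1 (multiplicity S) (fin S)).
rewrite !asboolT; [|by split=> //; lia|by split=> //; apply/TP; right].
congr (_ + card_of _); apply/seteqP; split=> x [[]] /=.
  by move=> /TP[[Sx xm]|->] //; lia.
move=> Sx xF xm; split; first by split=> //; apply/TP; left.
by move=> xh; rewrite xh in Sx.
Qed.

(** * Minimal generators and the embedding dimension of A(S) *)

Definition atoms (S : set nat) : set nat :=
  [set x | [/\ S x, 0 < x &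
    forall a b, S a -> S b -> 0 < a -> 0 < b -> x <> a + b]].

(** Removing an atom from S leaves a submonoid, so a generating set that missed the atom would
    generate too little. *)
Lemma atoms_sub_generators (A S : set nat) :
  submonoid S -> generates A S -> atoms S `<=` A.
Proof.
move=> [S0 SD] genA x [Sx x0 xP]; apply: contrapT => nAx.
have AS : A `<=` S by rewrite -genA; exact: sub_gen_smallest.
have subm : submonoid (S `\ x).
  split; first by split=> //=; lia.
  move=> a b [Sa /= ax] [Sb /= bx]; split; first exact: SD.
  move=> /= /esym; have [->|a0] := posnP a; first by move/esym.
  by have [->|b0] := posnP b; [rewrite addn0 => /esym|exact: xP].
have : (S `\ x) x.
  have := @smallest_sub _ submonoid A _ subm; rewrite genA; apply=> //.
  by move=> y Ay; split; [exact: AS|move=> /= yx; rewrite -yx in nAx].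
by case=> _ /(_ erefl).
Qed.

(** Strong induction: a nonzero element that is not an atom splits into two smaller elements of
    S. *)
Lemma generates_atoms (S : set nat) : submonoid S -> generates (atoms S) S.
Proof.
move=> smS; have [S0 SD] := smS.
apply/seteqP; split; first by apply: smallest_sub => // x [].
move=> x; elim/ltn_ind: x => x IH Sx M [smM atM]; have [M0 MD] := smM.
have [->//|x0] := posnP x.
have [/atM//|/not_and3P[]//] := pselect (atoms S x).
move=> /existsNP[a] /existsNP[b].
move=> /not_implyP[Sa] /not_implyP[Sb] /not_implyP[a0] /not_implyP[b0].
move=> /contrapT xab; rewrite xab.
by apply: MD; apply: IH; rewrite ?xab //; lia.
Qed.

(** The atoms generate S and lie in every generating set, so they form its only minimal one. This
    reduces the embedding dimension to counting elements. *)
Lemma minimal_generatorsE (S : set nat) :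
  submonoid S -> minimal_generators S = atoms S.
Proof.
move=> smS; apply/seteqP; split=> x.
  move=> [A [genA minA] Ax].
  by rewrite (minA _ (atoms_sub_generators smS genA) (generates_atoms smS)).
move=> xS; exists (atoms S) => //; split; first exact: generates_atoms.
move=> B BS genB; apply/seteqP; split=> //.
exact: atoms_sub_generators.
Qed.

Lemma finite_atoms (S : set nat) :
  numerical_semigroup S -> finite_set (atoms S).
Proof.
move=> numS; have [m0 Sm _] := multiplicityP numS.
have [_ /finite_set_bounded[b bP]] := numS.
(* With [b] a bound on the gaps, any x > b + m splits in S as m + (x - m). *)
apply: (@bounded_finite_set _ (b + multiplicity S)) => x [Sx x0 xP].
rewrite leqNgt; apply/negP => bx.
apply: (xP (multiplicity S) (x - multiplicity S)) => //; [|lia|lia].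
by apply: contrapT => /bP; lia.
Qed.

(* When some [y] with F - m < y < F is a gap, the largest gap below F is itself
   a special gap, hence it is [pivot S]. *)
Lemma gaps_gt_pivot (S : set nat) :
  numerical_semigroup S -> ~ special S ->
  ~ [set x | frobenius S + 1 <= x + multiplicity S /\ x < frobenius S] `<=` S ->
  forall y, ~ S y -> pivot S < y -> y = frobenius S.
Proof.
move=> numS nspS nint.
have [m0 Sm mP] := multiplicityP numS.
have [nSF FP] := frobeniusP numS (non_special_gaps nspS).
have [hSG mh hF hP] := pivotP numS nspS.
have /special_gapsP[nSh S2h _] := hSG.
(* The largest gap [z] below F is shown to be a special gap, which forces z = h. *)
have [||[nSz zF] zP] :=
    @maximumP [set y | ~ S y /\ y < frobenius S] (frobenius S).
- by exists (pivot S).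
- by move=> x [_ /ltnW].
move: (maximum _) nSz zF zP => z nSz zF zP.
have hz : pivot S <= z by exact: zP.
have Fz : frobenius S < z + multiplicity S.
  rewrite ltnNge; apply/negP => zmF; apply: nint => x [xF1 xF2].
  by apply: contrapT => nSx; have := zP x (conj nSx xF2); lia.
(* A gap 2z would equal F by the choice of [z], but F < z + m < 2z since m < h <= z. *)
have S2z : S (2 * z).
  apply: contrapT => nS2z.
  have [z2F|z2F] := ltnP (2 * z) (frobenius S).
    by have := zP _ (conj nS2z z2F); lia.
  by have := FP _ nS2z; lia.
have zh : z <= pivot S.
  apply: hP; last by lia.
  (* Here z + s >= z + m > F. *)
  apply/special_gapsP; split=> // s Ss s0; apply: contrapT => /FP.
  by have := mP _ Ss s0; lia.
move=> y nSy hy; have := FP _ nSy; rewrite leq_eqVlt => /orP[/eqP//|yF].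
by have := zP _ (conj nSy yF); lia.
Qed.

Lemma embdim_transfA (S : set nat) :
  numerical_semigroup S -> ~ special S ->
  ~ [set x | frobenius S + 1 <= x + multiplicity S /\ x < frobenius S] `<=` S ->
  embdim S <= embdim (transfA S).
Proof.
move=> numS nspS nint; have numT := transfA_numerical numS nspS.
have [[S0 SD] _] := numS; have [smT _] := numT.
have TP := transfAP _ numS nspS; have Tgt x := @transfA_gt S x numS nspS.
have [m0 Sm mP] := multiplicityP numS.
have [/special_gapsP[nSh _ _] mh hF _] := pivotP numS nspS.
rewrite /embdim !minimal_generatorsE //.
set m := multiplicity S in Tgt m0 Sm mP mh TP nint *.
set h := pivot S in nSh mh hF TP nint *; set F := frobenius S in hF nint *.
have atS := finite_atoms numS; have atT := finite_atoms numT.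
have hT : atoms (transfA S) h.
  split; [by apply/TP; right|by lia|move=> a b Ta Tb a0 b0 hab].
  case/TP: Ta => [[Sa _]|]; last by lia.
  case/TP: Tb => [[Sb _]|]; last by lia.
  by apply: nSh; rewrite hab; exact: SD.
have S2m : S (2 * m) by rewrite mul2n -addnn; exact: SD.
have h2m : 2 * m <> h by move=> h2m; rewrite h2m in S2m.
(* Nonzero elements of A(S) exceed m, so two of them never sum to 2m. *)
have T2m : atoms (transfA S) (2 * m).
  split; [by apply/TP; left; split=> //; lia|by lia|move=> a b Ta Tb a0 b0].
  by have := Tgt _ Ta a0; have := Tgt _ Tb b0; lia.
have n2m : ~ atoms S (2 * m) by move=> [_ _ /(_ m m)]; rewrite mul2n addnn; exact.
have nh : ~ atoms S h by move=> [].
(* The generators [m] and possibly [F + m] of S are lost, [h] and [2 m] are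
   gained. *)
have sub : atoms S `\ m `\ (F + m) `<=` atoms (transfA S) `\ h `\ (2 * m).
  move=> x [[xS /= xm] /= xFm].
  split; last by move=> /= x2; rewrite x2 in xS.
  split; last by move=> /= xh; rewrite xh in xS.
  have [Sx x0 xP] := xS.
  (* For an atom x = h + b of S, x - m is a gap, and it exceeds h because b > m; so it is F, and x
     is the excluded F + m. *)
  have key b : transfA S b -> 0 < b -> x <> h + b.
    move=> Tb b0 xhb; have mb := Tgt _ Tb b0.
    apply: xFm; suff : x - m = F by lia.
    apply: (gaps_gt_pivot numS nspS nint); last by rewrite -/h; lia.
    by move=> Sxm; apply: (xP m (x - m)) => //; lia.
  split=> //; first by apply/TP; left.
  move=> a b Ta Tb a0 b0 xab.
  case/TP: (Ta) => [[Sa _]|ah]; last by apply: (key b) => //; rewrite -ah.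
  case/TP: (Tb) => [[Sb _]|bh]; last by apply: (key a) => //; rewrite -bh addnC.
  exact: (xP a b).
rewrite (card_ofD1 m atS) (card_ofD1 (F + m) (finite_setD _ atS)).
rewrite (card_ofD1 h atT) (card_ofD1 (2 * m) (finite_setD _ atT)).
rewrite (asboolT hT) (asboolT (conj T2m h2m)).
have := leq_card_of (finite_setD _ (finite_setD _ atT)) sub.
by case: `[< _ >]; case: `[< _ >]; lia.
Qed.

Lemma wilf_transfA (S : set nat) :
  numerical_semigroup S -> ~ special S ->
  ~ [set x | frobenius S + 1 <= x + multiplicity S /\ x < frobenius S] `<=` S ->
  wilf S -> wilf (transfA S).
Proof.
move=> numS nspS nint; rewrite /wilf frobenius_transfA // nleft_transfA //.
by move=> wS; apply: (leq_trans wS); rewrite leq_mul2r embdim_transfA ?orbT.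
Qed.

Lemma Sgn_numerical (g n : nat) : 0 < g -> n <= g ->
  numerical_semigroup (Sgn g n).
Proof.
move=> g0 ng; split; last first.
  apply: (@bounded_finite_set _ (g + n)) => x nSx.
  rewrite leqNgt; apply/negP => gnx; apply: nSx; constructor 3; exact: ltnW.
split; first by constructor 1.
move=> x y xS yS.
have [->//|x0] := posnP x; have [->|y0] := posnP y; first by rewrite addn0.
(* Nonzero elements are at least g, and 2g >= g + n. *)
by constructor 3; case: xS => ?; case: yS => ?; lia.
Qed.

Lemma Hgn_numerical (g n : nat) (S : set nat) : 0 < g -> n <= g ->
  Hgn g n S -> numerical_semigroup S.
Proof. by move=> g0 ng [->|[]//]; exact: Sgn_numerical. Qed.

(* If S' is a child of S, then F - m(S') lies in S but not in S', so it is the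
   gap h of S' that was added; but then h + m(S') = F belongs to S'. *)
Lemma leaves_interval (g n : nat) (S : set nat) : 0 < g -> n <= g ->
  Hgn g n S ->
  [set x | frobenius S + 1 <= x + multiplicity S /\ x < frobenius S] `<=` S ->
  leaves g n S.
Proof.
move=> g0 ng HS int; split=> // -[S' [HS' nspS' ST]].
have numS' := Hgn_numerical g0 ng HS'; have numS := Hgn_numerical g0 ng HS.
have [m0 Sm mP] := multiplicityP numS'; have [m'0 Sm' _] := multiplicityP numS.
have [nSF FP] := frobeniusP numS' (non_special_gaps nspS').
have [/special_gapsP[nSh _ hP] mh hF _] := pivotP numS' nspS'.
have mm : multiplicity S' < multiplicity S.
  by apply: transfA_gt => //; rewrite -ST.
have FF : frobenius S = frobenius S' by rewrite ST frobenius_transfA.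
(* The subtraction is not truncated, as m(S') < h < F; the point falls in the interval because m(S')
   < m(S). *)
have : S (frobenius S' - multiplicity S').
  by apply: int => /=; lia.
rewrite {1}ST => /(transfAP _ numS' nspS')[[SFm _]|Fmh]; apply: nSF.
  have -> : frobenius S' = frobenius S' - multiplicity S' + multiplicity S'.
    by lia.
  by have [[_ SD] _] := numS'; exact: SD.
have -> : frobenius S' = pivot S' + multiplicity S' by lia.
exact: hP.
Qed.

(* [frobenius S + 1 <= x + multiplicity S] is F(S) - m(S) + 1 <= x, written
   without truncated subtraction. *)
Theorem theorem5p9 (g n : nat) (hg : 3 < g) (hn : 2 <= n <= g - 2)
    (leaves_wilf : forall S : set nat, leaves g n S -> wilf S)
    (parents_wilf : forall S : set nat, leaves g n S ->
       [set x | frobenius S + 1 <= x + multiplicity S /\ x < frobenius S]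
         `<=` S ->
       wilf (transfA S)) :
  forall S : set nat, Hgn g n S -> wilf S.
Proof.
have g0 : 0 < g by lia. have ng : n <= g by lia.
move=> S; have [k] := ubnP (multiplicity S); elim: k S => // k IH S Sk HS.
have [SL|] := pselect (leaves g n S); first exact: leaves_wilf.
(* A vertex that is not a leaf has a child [S'], from which Wilf's inequality is transported. *)
move=> /not_andP[//|/contrapT[S' [HS' nspS' ST]]].
have numS' := Hgn_numerical g0 ng HS'.
have [int|nint] := pselect ([set x | frobenius S' + 1 <= x + multiplicity S' /\
    x < frobenius S'] `<=` S').
  by rewrite ST; apply: parents_wilf => //; exact: leaves_interval.
rewrite ST; apply: wilf_transfA => //; apply: IH => //.
have [m0 Sm _] := multiplicityP (Hgn_numerical g0 ng HS).
suff : multiplicity S' < multiplicity S by lia.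
by apply: transfA_gt => //; rewrite -ST.
Qed.
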